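(* Let $D=(V(D),E(D),w)$ be a weighted oriented graph without isolated vertices, in which every source and every sink has weight $1$, and suppose that its underlying graph $G$ is a König graph. Then the edge ideal $I(D)$ is unmixed if and only if $D$ satisfies the following two conditions: (1) $G$ has a perfect matching $P$ with property (P), that is, $G$ has a perfect matching $P$ such that if $\{a,b\},\{a',b'\}\in E(G)$ and $\{b,b'\}\in P$, then $\{a,a'\}\in E(G)$; (2) (for this same $P$) if $a$ is a vertex of $D$ with $w(a)>1$, $b'\in N_D^+(a)$ and $\{b,b'\}\in P$, then $N_D(b)\subset N_D^+(a)$. Here $N_D^+(a)$ is the set of out-neighbors of $a$, and $N_D(b)$ is the set of all neighbors of $b$ (the union of its out-neighbors and its in-neighbors).
   Context: All graphs are finite and simple. A weighted oriented graph $D=(V(D),E(D),w)$ with underlying simple graph $G$ consists of $V(D)=V(G)$, a set $E(D)\subset V(D)\times V(D)$ with $E(G)=\{\{x,y\}: (x,y)\in E(D)\}$ and $|E(D)|=|E(G)|$ (each edge of $G$ gets exactly one direction), and a weight function $w:V(D)\to\mathbb{N}_+=\{1,2,\dots\}$. A source is a vertex with only outgoing edges; a sink is a vertex with only incoming edges. For a vertex $x$: the out-neighborhood is $N_D^+(x)=\{y:(x,y)\in E(D)\}$, the in-neighborhood is $N_D^-(x)=\{y:(y,x)\in E(D)\}$, and the neighborhood is their union, $N_D(x)=N_D^+(x)\cup N_D^-(x)$. If $V(D)=\{x_1,\dots,x_n\}$, view the vertices as variables of the polynomial ring $R=K[x_1,\dots,x_n]$, $K$ a field. The edge ideal of $D$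 is $I(D)=(x_ix_j^{w(x_j)} : (x_i,x_j)\in E(D))\subset R$. An ideal is unmixed if all its associated primes have the same height. A matching is a set of pairwise disjoint edges; it is perfect if it covers all vertices. A vertex cover is a set of vertices meeting every edge. $\nu(G)$ is the maximum cardinality of a matching of $G$, $\tau(G)$ the minimum cardinality of a vertex cover of $G$; $G$ is König if $\tau(G)=\nu(G)$. In condition (1), $a$ and $a'$ are not assumed distinct; since $G$ has no loops, the property in particular implies that no vertex is adjacent to both endpoints of an edge of $P$. *)

(* Defs.v *)
From mathcomp Require Import all_boot all_order all_algebra.
From mathcomp Require Import boolp.
From mathcomp Require Import mpoly.

Set Implicit Arguments.
Unset Strict Implicit.
Unset Printing Implicit Defensive.

Import GRing.Theory.
Local Open Scope ring_scope.

(* Simple graphs on a finite type are given by their adjacency relation, which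
   is meant to be symmetric and irreflexive; edges are two-element sets. *)
Section SimpleGraph.

Variables (T : finType) (e : rel T).

Definition edges : {set {set T}} := [set [set x; y] | x in T, y in e x].

Definition matching (M : {set {set T}}) : bool :=
  (M \subset edges) && trivIset M.

Definition perfect_matching (M : {set {set T}}) : bool :=
  matching M && (cover M == [set: T]).

Definition vertex_cover (C : {set T}) : bool :=
  [forall A in edges, C :&: A != set0].

Definition matching_number : nat := (\max_(M | matching M) #|M|)%N.

Definition vertex_cover_number : nat :=
  #|[arg min_(C < [set: T] | vertex_cover C) #|C|]|.

Definition Koenig : Prop := vertex_cover_number = matching_number.

Definition property_P (P : {set {set T}}) : Prop :=
  forall a b a' b' : T,
    e a b -> e a' b' -> [set b; b'] \in P -> e a a'.

End SimpleGraph.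

(* Asymmetry of [arc] says both that there are no loops and that every edge of
   the underlying graph is given exactly one direction. *)
Record wograph (T : finType) := WOGraph {
  arc : rel T;
  weight : T -> nat;
  arc_asym : forall x y, arc x y -> ~~ arc y x;
  weight_gt0 : forall x, (0 < weight x)%N
}.

Section WeightedOrientedGraph.

Variables (T : finType) (D : wograph T).

Definition underlying : rel T := fun x y => arc D x y || arc D y x.

Definition out_nbhd (x : T) : {set T} := [set y | arc D x y].
Definition in_nbhd (x : T) : {set T} := [set y | arc D y x].
Definition nbhd (x : T) : {set T} := out_nbhd x :|: in_nbhd x.

Definition isolated (x : T) : bool := nbhd x == set0.
Definition source (x : T) : bool := in_nbhd x == set0.
Definition sink (x : T) : bool := out_nbhd x == set0.

Definition weight_condition (P : {set {set T}}) : Prop :=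
  forall a b b' : T,
    (1 < weight D a)%N -> b' \in out_nbhd a -> [set b; b'] \in P ->
    nbhd b \subset out_nbhd a.

End WeightedOrientedGraph.

Section Ideals.

Variable R : comNzRingType.
Implicit Types (I p q : {pred R}) (h : nat).

Definition ideal_gen (S : R -> Prop) : {pred R} := fun f =>
  `[< exists s : seq (R * R),
        (forall cg, cg \in s -> S cg.2) /\ f = \sum_(cg <- s) cg.1 * cg.2 >].

(* [idealr_closed] includes properness. *)
Definition prime_ideal p : Prop := idealr_closed p /\ prime_idealr_closed p.

(* p = (I : f) for some f, i.e. p is the annihilator of an element of R / I. *)
Definition associated_prime I p : Prop :=
  prime_ideal p /\ exists f : R, forall g : R, (g \in p) = (f * g \in I).

(* c 0 < c 1 < ... < c h = p, with h strict inclusions *)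
Definition prime_chain p h : Prop :=
  exists c : nat -> {pred R},
    [/\ forall i, (i <= h)%N -> prime_ideal (c i),
        forall i, (i < h)%N ->
          {subset c i <= c i.+1} /\ ~ {subset c i.+1 <= c i}
      & c h =i p].

Definition has_height p h : Prop :=
  prime_chain p h /\ forall h', prime_chain p h' -> (h' <= h)%N.

(* A prime satisfying [has_height] for no h has infinite height, so this is
   equality of heights with values in nat extended by infinity. *)
Definition unmixed I : Prop :=
  forall p q, associated_prime I p -> associated_prime I q ->
    forall h, has_height p h <-> has_height q h.

End Ideals.

Definition edge_ideal (K : fieldType) (n : nat) (D : wograph 'I_n) :
    {pred {mpoly K[n]}} :=
  ideal_gen (fun f : {mpoly K[n]} =>
    exists i j : 'I_n, arc D i j /\ f = 'X_i * 'X_j ^+ weight D j).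

Arguments edge_ideal K {n} D.

(* Main.v *)
(** Primes associated to a monomial ideal [J] have the form [(x_i : i in C)] and
    equal [(J : m)] for a monomial [m].  Their heights depend only on [#|C|],
    because permuting the variables is an automorphism, and increase strictly
    with [#|C|], because chains of primes in n variables have length at most n:
    elements picked along a chain are algebraically independent.  So [I(D)] is
    unmixed iff all covers [C] with [(I(D) : m) = (x_i : i in C)] for some
    monomial [m] have the same cardinality.

    If [P] satisfies both conditions, such a [C] meets each edge of [P] once, as
    the reasons for both endpoints to be in [C] would conflict along the edge
    that property (P) provides.  Conversely, every maximal independent set is
    the complement of such a [C]; so, by the Koenig property, every [C] meets
    each edge of a maximum matching once and has no other vertex, which makes
    this matching perfect with property (P).  A violation [(c, a)] of the weight
    condition at [(a, b')] gives a [C] containing both [b] and [b']: the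
    complement of a set containing [c] that is maximal among the independent
    sets avoiding [a] and its out-neighbors. *)

Require Import Defs.
From mathcomp Require Import all_boot all_algebra all_fingroup.
From mathcomp Require Import boolp.
From mathcomp Require Import mpoly.
(* Again, because [path.arc] hides [Defs.arc]. *)
Import Defs.

Set Implicit Arguments.
Unset Strict Implicit.
Unset Printing Implicit Defensive.

Import GRing.Theory.
Local Open Scope ring_scope.

(** * Chains of prime ideals *)

Section PrimeChains.

Variable R : comNzRingType.
Implicit Types (p q : {pred R}) (h : nat).

Lemma prime_ideal0 p : prime_ideal p -> 0 \in p.
Proof. by case=> -[]. Qed.

Lemma prime_ideal1 p : prime_ideal p -> 1 \notin p.
Proof. by case=> -[]. Qed.

Lemma prime_idealD p f g : prime_ideal p -> f \in p -> g \in p -> f + g \in p.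
Proof. by case=> -[_ _ cl] _ fp gp; rewrite -[f]mul1r; exact: cl. Qed.

Lemma prime_idealMl p f g : prime_ideal p -> g \in p -> f * g \in p.
Proof. by case=> -[z _ cl] _ gp; rewrite -[_ * _]addr0; exact: cl. Qed.

Lemma prime_idealMr p f g : prime_ideal p -> f \in p -> f * g \in p.
Proof. by move=> pp fp; rewrite mulrC prime_idealMl. Qed.

Lemma prime_idealN p f : prime_ideal p -> f \in p -> - f \in p.
Proof. by move=> pp fp; rewrite -mulN1r prime_idealMl. Qed.

Lemma prime_idealDl p f g : prime_ideal p -> f \in p -> (f + g \in p) = (g \in p).
Proof.
move=> pp fp; apply/idP/idP => [fgp|]; last exact: prime_idealD.
by rewrite -[g](addKr f) prime_idealD // prime_idealN.
Qed.

Lemma prime_idealM p f g : prime_ideal p -> (f * g \in p) = (f \in p) || (g \in p).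
Proof.
move=> pp; apply/idP/orP => [fgp|[fp|gp]]; last 2 first.
- exact: prime_idealMr.
- exact: prime_idealMl.
by apply/orP; case: pp => _ pr; exact: pr.
Qed.

Lemma prime_ideal_sum p (I : Type) (r : seq I) (P : pred I) (F : I -> R) :
  prime_ideal p -> (forall i, P i -> F i \in p) -> \sum_(i <- r | P i) F i \in p.
Proof.
move=> pp Fp; elim/big_rec: _ => [|i x Pi xp]; first exact: prime_ideal0.
by apply: prime_idealD => //; exact: Fp.
Qed.

Lemma prime_ideal_prod p (I : Type) (r : seq I) (F : I -> R) :
  prime_ideal p -> (\prod_(i <- r) F i \in p) = has (fun i => F i \in p) r.
Proof.
move=> pp; elim: r => [|i r IH]; first by rewrite big_nil (negbTE (prime_ideal1 pp)).
by rewrite big_cons prime_idealM // IH.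
Qed.

Lemma prime_idealX p f k : prime_ideal p -> (f ^+ k \in p) = (0 < k)%N && (f \in p).
Proof.
move=> pp; elim: k => [|k IH]; first by rewrite expr0 (negbTE (prime_ideal1 pp)).
by rewrite exprS prime_idealM // IH; case: (f \in p); rewrite ?andbF.
Qed.

Lemma eq_prime_chain p q h : p =i q -> prime_chain p h -> prime_chain q h.
Proof. by move=> pq [c [c1 c2 c3]]; exists c; split=> // x; rewrite c3. Qed.

Lemma prime_chain0 p : prime_ideal p -> prime_chain p 0.
Proof. by move=> pp; exists (fun=> p). Qed.

Lemma prime_chainS p q h : prime_ideal q ->
  {subset p <= q} -> ~ {subset q <= p} -> prime_chain p h -> prime_chain q h.+1.
Proof.
move=> qq pq npq [c [c1 c2 c3]].
exists (fun i => if (i <= h)%N then c i else q); split.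
- by move=> i; case: ifP => // + _; exact: c1.
- move=> i; rewrite ltnS => ih; rewrite ih.
  case: ltnP => [lt|ge]; first exact: c2.
  have -> : i = h by apply/eqP; rewrite eqn_leq ih.
  by split=> [x|sub]; [rewrite c3; apply: pq | apply: npq => x /sub; rewrite c3].
- by rewrite ltnn.
Qed.

Lemma prime_chain_bounded_height p N : prime_ideal p ->
  (forall h, prime_chain p h -> (h <= N)%N) -> exists h, has_height p h.
Proof.
move=> pp bN.
have ex : exists h, `[< prime_chain p h >].
  by exists 0%N; apply/asboolP; exact: prime_chain0.
have bd h : `[< prime_chain p h >] -> (h <= N)%N by move/asboolP; exact: bN.
case: (ex_maxnP ex bd) => h /asboolP ch mx; exists h; split=> // h' ch'.
by apply: mx; apply/asboolP.
Qed.

End PrimeChains.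

Lemma prime_ideal_preim (R S : comNzRingType) (phi : {rmorphism R -> S})
    (p : {pred S}) :
  prime_ideal p -> prime_ideal [pred f | phi f \in p].
Proof.
move=> [[z o cl] pr]; split; first split.
- by rewrite inE rmorph0.
- by rewrite inE rmorph1.
- by move=> a u v; rewrite !inE rmorphD rmorphM; exact: cl.
- by move=> u v; rewrite !inE rmorphM; exact: pr.
Qed.

(** Surjectivity of [phi] keeps the inclusions strict: an element that separates two primes of the
    chain has a preimage, which separates their preimages. *)
Lemma prime_chain_preim (R S : comNzRingType) (phi : {rmorphism R -> S})
    (p : {pred S}) h :
  (forall g, exists f, phi f = g) ->
  prime_chain p h -> prime_chain [pred f | phi f \in p] h.
Proof.
move=> surj [c [c1 c2 c3]].
exists (fun i => [pred f | phi f \in c i] : {pred R}); split.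
- by move=> i ih; exact/prime_ideal_preim/c1.
- move=> i ih; have [sub nsub] := c2 i ih; split=> [f|sub'].
    by rewrite !inE; exact: sub.
  by apply: nsub => g; have [f <-] := surj g; have := sub' f; rewrite !inE.
- by move=> f; rewrite !inE c3.
Qed.

(** * Algebraic independence along chains of primes, which bounds their length by [n] *)

Section AlgebraicIndependence.

Variables (K : fieldType) (n : nat).
Implicit Types (p : {pred {mpoly K[n]}}).

Lemma mpolyC_in_prime p (a : K) : prime_ideal p -> (a%:MP \in p) = (a == 0).
Proof.
move=> pp; apply/idP/eqP => [ap|->]; last exact: prime_ideal0.
apply/eqP/negPn/negP => a0; case/negP: (prime_ideal1 pp).
have -> : 1 = a^-1%:MP * a%:MP :> {mpoly K[n]} by rewrite -mpolyCM mulVf.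
exact: prime_idealMl.
Qed.

(* Both [E] and the partial products shrink as [i] grows: among the terms left
   in [E], those with the smallest exponent of [f i] are kept. *)
Lemma prime_chain_alg_indep (T : finType) (ex : T -> nat -> nat) (a : T -> K)
    (h : nat) (c : nat -> {pred {mpoly K[n]}}) (f : nat -> {mpoly K[n]}) :
    (forall s t, (forall i, (i < h)%N -> ex s i = ex t i) -> s = t) ->
    (forall i, (i <= h)%N -> prime_ideal (c i)) ->
    (forall i, (i < h)%N -> {subset c i <= c i.+1}) ->
    (forall i, (i < h)%N -> (f i \in c i.+1) && (f i \notin c i)) ->
    \sum_t (a t)%:MP * \prod_(0 <= i < h) f i ^+ ex t i = 0 ->
  forall t, a t = 0.
Proof.
move=> exI cP cS fP rel t0; apply/eqP/negPn/negP => at0.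
(* The terms in [E] share their exponents of [f j] for [j < i]; at [i = h] a single term is left,
   and its nonzero constant lies in a prime. *)
have main i : (i <= h)%N -> exists E : {set T},
  [/\ E != set0, forall t, t \in E -> a t != 0,
      {in E &, forall s t j, (j < i)%N -> ex s j = ex t j}
    & \sum_(t in E) (a t)%:MP * \prod_(i <= j < h) f j ^+ ex t j \in c i].
  elim: i => [_|i IH ih].
    exists [set t | a t != 0]; split=> //.
    - by apply/set0Pn; exists t0; rewrite inE.
    - by move=> t; rewrite inE.
    rewrite (_ : \sum_(t in _) _ = 0); first exact/prime_ideal0/cP.
    rewrite -[RHS]rel [RHS](bigID (fun t => a t != 0)) /=.
    rewrite [X in _ = _ + X]big1 ?addr0; first by apply: eq_bigl => t; rewrite inE.
    by move=> t; rewrite negbK => /eqP ->; rewrite mul0r.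
  have [E [/set0Pn[t1 t1E] Ea Eex Ec]] := IH (ltnW ih).
  have [t2 t2E t2min] := arg_minnP (fun t => ex t i) t1E.
  have ci := cP _ (ltnW ih); have ci1 := cP _ ih.
  have /andP[fi1 fi] := fP _ ih.
  exists [set t in E | ex t i == ex t2 i]; split.
  - by apply/set0Pn; exists t2; rewrite inE eqxx andbT.
  - by move=> t; rewrite inE => /andP[/Ea].
  - move=> s t; rewrite !inE => /andP[sE /eqP si] /andP[tE /eqP ti] j.
    by rewrite ltnS leq_eqVlt => /orP[/eqP ->|]; [rewrite si ti | exact: Eex].
  pose g t := (a t)%:MP * \prod_(i.+1 <= j < h) f j ^+ ex t j.
  have : f i ^+ ex t2 i * (\sum_(t in E) f i ^+ (ex t i - ex t2 i) * g t) \in c i.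
    have <- // : \sum_(t in E) (a t)%:MP * \prod_(i <= j < h) f j ^+ ex t j =
                f i ^+ ex t2 i * \sum_(t in E) f i ^+ (ex t i - ex t2 i) * g t.
    rewrite mulr_sumr; apply: eq_bigr => t tE.
    rewrite big_ltn // [RHS]mulrA -exprD subnKC; last exact: t2min.
    by rewrite /g mulrCA.
  (* The common power of [f i] cancels since [f i] is outside [c i]; modulo [c i.+1], which contains
     [f i], only the terms of smallest exponent remain. *)
  rewrite prime_idealM // prime_idealX // (negbTE fi) andbF /= => /(cS _ ih).
  rewrite (bigID (fun t => ex t i == ex t2 i)) /= addrC prime_idealDl //.
    have -> // : \sum_(t in E | ex t i == ex t2 i) f i ^+ (ex t i - ex t2 i) * g t =
                \sum_(t in [set t in E | ex t i == ex t2 i]) g t.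
    apply: eq_big => [t|t /andP[_ /eqP ->]]; first by rewrite inE.
    by rewrite subnn expr0 mul1r.
  apply: prime_ideal_sum => // t /andP[tE tne].
  apply: prime_idealMr => //; rewrite prime_idealX // fi1 andbT subn_gt0.
  by rewrite ltn_neqAle eq_sym tne t2min.
have [E [/set0Pn[t tE] Ea Eex]] := main h (leqnn h).
have -> : E = [set t].
  apply/setP => s; rewrite inE; apply/idP/eqP => [sE|->//].
  by apply: exI => i ih; exact: Eex.
rewrite big_set1 big_geq // mulr1 mpolyC_in_prime; last exact: cP.
by rewrite (negbTE (Ea _ tE)).
Qed.

(** A monomial of degree below [b] is determined by its [n] exponents, each below [b]. *)
Lemma card_bmultinom_le b : (#|{: 'X_{1..n < b}}| <= b ^ n)%N.
Proof.
case: b => [|b].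
  by rewrite (_ : #|_| = 0%N) //; apply: eq_card0 => -[m].
rewrite -[X in (X ^ _)%N]card_ord -[X in (_ ^ X)%N](card_ord n) -card_ffun.
apply: (@leq_card _ _ (fun m : 'X_{1..n < b.+1} =>
  [ffun i => inord (m i)] : {ffun 'I_n -> 'I_b.+1})) => m1 m2 /ffunP e.
apply/val_inj/mnmP => i.
have /(congr1 val) := e i; rewrite !ffunE /= !inordK //.
  by apply: leq_trans (bmdeg m2); rewrite ltnS mdegE (bigD1 i) //= leq_addr.
by apply: leq_trans (bmdeg m1); rewrite ltnS mdegE (bigD1 i) //= leq_addr.
Qed.

(** Degrees add up in a product; [msize] is the degree plus one, and 0 for the zero polynomial. *)
Lemma msize_prod_le (I : Type) (r : seq I) (g : I -> {mpoly K[n]}) :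
  (msize (\prod_(i <- r) g i) <= (\sum_(i <- r) (msize (g i)).-1).+1)%N.
Proof.
elim: r => [|i r IH]; first by rewrite !big_nil msize1.
rewrite !big_cons; have [->|gi0] := eqVneq (g i) 0; first by rewrite mul0r msize0.
have [->|p0] := eqVneq (\prod_(j <- r) g j) 0; first by rewrite mulr0 msize0.
rewrite msizeM // -addnS; apply: leq_trans (leq_add (leqnn _) IH).
by move: gi0; rewrite -msize_poly_eq0; case: (msize (g i)).
Qed.

Lemma msizeX_le (g : {mpoly K[n]}) e :
  ((msize (g ^+ e)).-1 <= e * msize g)%N.
Proof.
rewrite -[e in g ^+ e]card_ord -prodr_const.
apply: leq_trans (_ : (\sum_(i < e) (msize g).-1) <= _)%N.
  by rewrite -subn1 leq_subLR add1n; exact: msize_prod_le.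
by rewrite sum_nat_const card_ord leq_mul // leq_pred.
Qed.

(* There are [N ^ n.+1] monomials in [n.+1] polynomials with exponents below
   [N], and they lie in a space of dimension O(N ^ n). *)
Lemma mpoly_alg_dependent (f : nat -> {mpoly K[n]}) :
  exists (N : nat) (a : {ffun 'I_n.+1 -> 'I_N} -> K),
    (exists t, a t != 0) /\
    \sum_t (a t)%:MP * \prod_(i < n.+1) f i ^+ t i = 0.
Proof.
(* The products have degree at most [n.+1 * (N * d)], which is below [b = N * M]; and [M ^ n < N]
   gives [b ^ n < N ^ n.+1]. *)
pose d := (\max_(i < n.+1) msize (f i))%N.
pose M := (n.+1 * d).+1%N.
pose N := (M ^ n).+1%N.
pose b := (N * M)%N.
have bN : (b ^ n < N ^ n.+1)%N.
  by rewrite /b expnMn expnS mulnC ltn_mul2r expn_gt0 /= /N ltnS.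
pose T := {ffun 'I_n.+1 -> 'I_N}.
pose B := 'X_{1..n < b}.
pose F (t : T) := \prod_(i < n.+1) f i ^+ t i.
pose A := \matrix_(i < #|{: T}|, j < #|{: B}|) (F (enum_val i))@_(enum_val j : B).
have rk : (\rank A < #|{: T}|)%N.
  apply: leq_ltn_trans (rank_leq_col _) _; apply: leq_ltn_trans (card_bmultinom_le _) _.
  by rewrite card_ffun !card_ord.
(* Row [i] of [A] lists the coefficients of one product. There are more rows than columns, so a
   nonzero row of the kernel matrix provides the relation. *)
have kn0 : kermx A != 0.
  by rewrite -mxrank_eq0 mxrank_ker subn_eq0 -ltnNge.
have [i [j kij]] : exists i j, kermx A i j != 0.
  apply: contrapT => H; case/eqP: kn0; apply/matrixP => i j; rewrite [RHS]mxE.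
  by apply/eqP/negPn/negP => H'; apply: H; exists i, j.
exists N, (fun t => kermx A i (enum_rank t)); split.
  by exists (enum_val j); rewrite enum_valK.
have szF t m : (b <= mdeg m)%N -> (F t)@_m = 0.
  move=> bm; apply: memN_msupp_eq0; apply: msize_mdeg_ge; apply: leq_trans bm.
  apply: leq_trans (msize_prod_le _ _) _.
  apply: leq_trans (_ : (\sum_(i < n.+1) N * d).+1 <= _)%N.
    rewrite ltnS leq_sum // => l _; apply: leq_trans (msizeX_le _ _) _.
    by rewrite leq_mul // ?(ltnW (ltn_ord _)) // /d; exact: leq_bigmax.
  rewrite sum_nat_const card_ord /b /M.
  by rewrite mulnS mulnCA addnC -[X in (X < _)%N]addn0 ltn_add2l.
apply/mpolyP => m; rewrite mcoeff0 raddf_sum /=.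
under eq_bigr do rewrite mcoeffCM.
have [bm|mb] := leqP b (mdeg m).
  by rewrite big1 // => t _; rewrite (szF t m bm) mulr0.
have /matrixP/(_ i (enum_rank (BMultinom mb))) := mulmx_ker A.
rewrite [RHS]mxE mxE => ker0; rewrite -[RHS]ker0 [RHS](reindex enum_rank) /=; last first.
  by apply: onW_bij; exact: enum_rank_bij.
by apply: eq_bigr => t _; rewrite [A _ _]mxE !enum_rankK.
Qed.

(** In a longer chain, elements picked from the first [n.+1] strict inclusions would be
    algebraically independent, against [mpoly_alg_dependent]. *)
Lemma prime_chain_le p h : prime_chain p h -> (h <= n)%N.
Proof.
move=> [c [c1 c2 c3]]; rewrite leqNgt; apply/negP => nh.
have /choice[f fP] : forall i, exists g : {mpoly K[n]},
    (i < h)%N -> (g \in c i.+1) && (g \notin c i).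
  move=> i; case: ltnP => [ih|_]; last by exists 0.
  have [_ nsub] := c2 i ih; apply: contrapT => H; apply: nsub => g gi.
  by apply/negPn/negP => gi'; apply: H; exists g; rewrite gi gi'.
have [N [a [[t at0] rel]]] := mpoly_alg_dependent f.
case/eqP: at0.
move: t; apply: (@prime_chain_alg_indep {ffun 'I_n.+1 -> 'I_N}
  (fun t i => nat_of_ord (t (inord i))) a n.+1 c f).
- move=> s t st; apply/ffunP => i; apply/val_inj.
  by have := st i (ltn_ord i); rewrite inord_val.
- by move=> i ih; apply: c1; apply: leq_trans nh.
- by move=> i ih; have [] := c2 i (leq_trans ih nh).
- by move=> i ih; apply: fP; apply: leq_trans nh.
rewrite -[RHS]rel; apply: eq_bigr => t _; congr (_ * _).
by rewrite big_mkord; apply: eq_bigr => i _; rewrite inord_val.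
Qed.

End AlgebraicIndependence.

(** * Associated primes of monomial ideals *)

Section MonomialIdeals.

Variables (K : fieldType) (n : nat).
Implicit Types (J : pred 'X_{1..n}) (C : {set 'I_n}) (k m : 'X_{1..n}).
Implicit Types (f g : {mpoly K[n]}) (p : {pred {mpoly K[n]}}).

(** A monomial ideal is encoded by the exponents of its monomials; this gives an ideal once [J] is
    closed under adding exponents. *)
Definition mon_ideal J : {pred {mpoly K[n]}} := [pred f | all J (msupp f)].

Lemma mem_mon_ideal J f : (f \in mon_ideal J) = all J (msupp f).
Proof. by []. Qed.

(** The exponents of the monomials in the ideal generated by the variables in [C]. *)
Definition meets C k := [exists i in C, (0 < k i)%N].

Lemma meetsD C k m : meets C (k + m)%MM = meets C k || meets C m.
Proof.
apply/existsP/orP => [[i /andP[iC]]|[]/existsP[i /andP[iC ki]]].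
- rewrite mnmDE addn_gt0 => /orP[] ki; [left|right];
  by apply/existsP; exists i; rewrite iC.
- by exists i; rewrite iC mnmDE addn_gt0 ki.
- by exists i; rewrite iC mnmDE addn_gt0 ki orbT.
Qed.

Lemma meets0 C : meets C 0%MM = false.
Proof. by apply/existsP => -[i]; rewrite mnm0E andbF. Qed.

Lemma meetsU C i : meets C U_(i)%MM = (i \in C).
Proof.
apply/existsP/idP => [[j /andP[jC]]|iC]; last by exists i; rewrite iC mnm1E eqxx.
by rewrite mnm1E; case: eqP => // ->.
Qed.

Section UpwardClosed.

Variable J : pred 'X_{1..n}.
Hypothesis J_up : forall k m, J m -> J (k + m)%MM.

Lemma mon_ideal0 : 0 \in mon_ideal J.
Proof. by rewrite inE msupp0. Qed.

Lemma mon_idealD f g :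
  f \in mon_ideal J -> g \in mon_ideal J -> f + g \in mon_ideal J.
Proof.
rewrite !inE => /allP fJ /allP gJ; apply/allP => m /msuppD_le.
by rewrite mem_cat => /orP[/fJ|/gJ].
Qed.

Lemma mon_idealMl f g : g \in mon_ideal J -> f * g \in mon_ideal J.
Proof.
rewrite !inE => /allP gJ; apply/allP => m /msuppM_le/allpairsP[[k l] /= [_ /gJ lJ ->]].
exact: J_up.
Qed.

Lemma mon_idealMr f g : f \in mon_ideal J -> f * g \in mon_ideal J.
Proof. by rewrite mulrC; exact: mon_idealMl. Qed.

Lemma mon_ideal_sum (I : eqType) (r : seq I) (F : I -> {mpoly K[n]}) :
  (forall i, i \in r -> F i \in mon_ideal J) -> \sum_(i <- r) F i \in mon_ideal J.
Proof.
move=> FJ; rewrite big_seq; elim/big_rec: _ => [|i x ir xJ]; first exact: mon_ideal0.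
by apply: mon_idealD => //; exact: FJ.
Qed.

Lemma mon_idealX m : ('X_[m] \in mon_ideal J) = J m.
Proof. by rewrite inE msuppX /= andbT. Qed.

Lemma mon_idealN f : (- f \in mon_ideal J) = (f \in mon_ideal J).
Proof. by rewrite !inE; apply: perm_all; exact: msuppN. Qed.

(** Serves to replace a polynomial by a congruent one with fewer terms. *)
Lemma mon_ideal_trunc f :
  f - \sum_(m <- [seq m <- msupp f | ~~ J m]) f@_m *: 'X_[m] \in mon_ideal J.
Proof.
rewrite {1}[f]mpolyE (bigID J) /= big_filter addrK big_seq_cond.
elim/big_rec: _ => [|m x /andP[mf mJ] xJ]; first exact: mon_ideal0.
by apply: mon_idealD => //; rewrite -mul_mpolyC mon_idealMl // mon_idealX.
Qed.

End UpwardClosed.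

Lemma meets_up C k m : meets C m -> meets C (k + m)%MM.
Proof. by rewrite meetsD => ->; rewrite orbT. Qed.

Definition var_ideal C : {pred {mpoly K[n]}} := mon_ideal (meets C).

(** An endomorphism with kernel [var_ideal C]; that ideal is therefore prime, as the polynomial ring
    is a domain. *)
Definition kill_vars C f := f \mPo [tuple if i \in C then 0 else 'X_i | i < n].

Lemma mcoeff_kill_vars C f m :
  (kill_vars C f)@_m = if meets C m then 0 else f@_m.
Proof.
have killX k : kill_vars C 'X_[k] = if meets C k then 0 else 'X_[k].
  rewrite /kill_vars comp_mpolyX; case: ifP => [/existsP[i /andP[iC ki]]|/existsP kC].
    by rewrite (bigD1 i) //= tnth_mktuple iC expr0n eqn0Ngt ki mul0r.
  rewrite [RHS]mpolyXE_id; apply: eq_bigr => i _; rewrite tnth_mktuple.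
  case: ifP => // iC; case: (posnP (k i)) => [->|ki]; first by rewrite !expr0.
  by case: kC; exists i; rewrite iC.
rewrite /kill_vars comp_mpolyEX raddf_sum /=.
have -> : (if meets C m then 0 else f@_m) =
    \sum_(k <- msupp f) (if meets C k then 0 else f@_k *: 'X_[k])@_m.
  case: ifP => mC.
    rewrite big1 // => k _; case: ifP => kC; first by rewrite mcoeff0.
    by rewrite mcoeffZ mcoeffX; case: eqP kC => [->|_ _]; rewrite ?mC ?mulr0.
  rewrite {1}[f]mpolyE raddf_sum /=; apply: eq_bigr => k _; case: ifP => // kC.
  by rewrite mcoeff0 mcoeffZ mcoeffX; case: eqP kC mC => [->->//|]; rewrite mulr0.
apply: eq_bigr => k _; rewrite -/(kill_vars C _) killX.
by case: ifP; rewrite // scaler0.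
Qed.

Lemma var_idealE C f : (f \in var_ideal C) = (kill_vars C f == 0).
Proof.
rewrite inE; apply/allP/eqP => [fC|kf m mf].
  apply/mpolyP => m; rewrite mcoeff_kill_vars mcoeff0; case: ifPn => // mC.
  by apply: memN_msupp_eq0; apply/negP => /fC; rewrite (negbTE mC).
apply: contraT => mC; move: mf; rewrite mcoeff_msupp => /eqP[].
by move/mpolyP/(_ m): kf; rewrite mcoeff_kill_vars (negbTE mC) mcoeff0.
Qed.

Lemma prime_var_ideal C : prime_ideal (var_ideal C).
Proof.
split; first split.
- exact: mon_ideal0.
- by rewrite inE msupp1 /= andbT meets0.
- move=> a u v uC vC; apply: mon_idealD => //.
  by apply: mon_idealMl => //; exact: meets_up.
- move=> u v; rewrite !var_idealE.
  by rewrite /kill_vars rmorphM mulf_eq0.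
Qed.

Lemma var_idealX C k : ('X_[k] \in var_ideal C) = meets C k.
Proof. exact: mon_idealX. Qed.

Lemma prime_mpolyX p m : prime_ideal p ->
  ('X_[m] \in p) = meets [set i | 'X_i \in p] m.
Proof.
move=> pp; rewrite mpolyXE_id prime_ideal_prod //.
apply/hasP/existsP => [[i _]|[i]].
  by rewrite prime_idealX // => /andP[mi ip]; exists i; rewrite inE ip.
rewrite inE => /andP[ip mi].
by exists i; rewrite ?mem_index_enum // prime_idealX // mi.
Qed.

(* A monomial [u] outside [p] multiplies no term of [f] into the ideal, as
   otherwise [p = (I : u f)] with [u f] congruent to a shorter polynomial. *)
Lemma associated_prime_mon_ideal J p :
    (forall k m, J m -> J (k + m)%MM) -> associated_prime (mon_ideal J) p ->
  exists C m, p =i var_ideal C /\ forall k, J (m + k)%MM = meets C k.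
Proof.
move=> J_up [pp [f0 f0P]]; have [_ o _] := pp.1.
pose ann (f : {mpoly K[n]}) := forall g, (g \in p) = (f * g \in mon_ideal J).
(* Among the polynomials [f] with [p = (I : f)], one with the fewest terms is taken. *)
have exN : exists N, `[< exists f, ann f /\ size (msupp f) = N >].
  by exists (size (msupp f0)); apply/asboolP; exists f0.
have [N /asboolP[f [fP fN]] Nmin] := ex_minnP exN.
have ann_congr f1 f2 : f1 - f2 \in mon_ideal J -> ann f1 -> ann f2.
  move=> f12 a1 g; rewrite a1 -[f1](subrK f2) mulrDl.
  have H : (f1 - f2) * g \in mon_ideal J by exact: mon_idealMr.
  apply/idP/idP => [|?]; last exact: mon_idealD.
  by move=> H'; rewrite -[f2 * g](addKr ((f1 - f2) * g)) mon_idealD // mon_idealN.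
have annX u : 'X_[u] \notin p -> ann (f * 'X_[u]).
  by move=> up g; rewrite -mulrA -fP prime_idealM // (negbTE up).
have key u m : 'X_[u] \notin p -> m \in msupp f -> ~~ J (u + m)%MM.
  move=> up mf; apply/negP => umJ.
  have := ann_congr _ _ (mon_ideal_trunc J_up (f * 'X_[u])) (annX u up).
  set s := [seq _ <- _ | _]; set f' := \sum_(_ <- s) _ => af'.
  have: (N <= size (msupp f'))%N by apply: Nmin; apply/asboolP; exists f'.
  have -> : size (msupp f') = size s.
    apply/perm_size/msupp_sumX; first exact/filter_uniq/msupp_uniq.
    by move=> k; rewrite mem_filter mcoeff_msupp => /andP[].
  rewrite /s size_filter (seq.permP (msuppMX _ _)) count_map leqNgt -fN => /negP; apply.
  rewrite -count_predT; apply: leq_trans (_ : count (predC1 m) (msupp f) < _)%N.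
    rewrite ltnS; apply: sub_count => k /=; apply: contra => /eqP ->; exact: umJ.
  rewrite count_predT -(count_predC (pred1 m)) -add1n leq_add2r.
  by rewrite -has_count has_pred1.
have keyX u m : m \in msupp f -> J (m + u)%MM = ('X_[u] \in p).
  move=> mf; apply/idP/idP => [muJ|].
    by apply/negPn/negP => /key/(_ mf); rewrite addmC muJ.
  rewrite fP inE (perm_all _ (msuppMX _ _)) all_map => /allP/(_ m mf).
  by rewrite /= addmC.
have f_neq0 : f != 0.
  by apply/eqP => f_eq0; move: o; rewrite fP f_eq0 mul0r mon_ideal0.
have mf := mlead_supp f_neq0.
exists [set i | 'X_i \in p], (mlead f); split; last first.
  by move=> k; rewrite keyX // prime_mpolyX.
move=> g; rewrite inE; apply/idP/allP => [gp m mg|gC].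
  rewrite -prime_mpolyX //; apply/negPn/negP => mp.
  (* Dropping from [g] its terms in [p] leaves [g'] in [p], nonzero because of [m]. The leading
     exponent of [f * g'] then lies in [J], against [key]. *)
  pose Q : pred 'X_{1..n} := fun k => 'X_[k] \in p.
  have Q_up k l : Q l -> Q (k + l)%MM by rewrite /Q mpolyXD; exact: prime_idealMl.
  pose s := [seq k <- msupp g | ~~ Q k]; pose g' := \sum_(k <- s) g@_k *: 'X_[k].
  have sg' : perm_eq (msupp g') s.
    apply: msupp_sumX; first exact/filter_uniq/msupp_uniq.
    by move=> k; rewrite mem_filter mcoeff_msupp => /andP[].
  have gg' : g - g' \in p.
    have /allP := mon_ideal_trunc Q_up g; rewrite -/s -/g' => H.
    rewrite [g - g']mpolyE big_seq; apply: prime_ideal_sum => // k /H kQ.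
    by rewrite -mul_mpolyC; exact: prime_idealMl.
  have g'p : g' \in p by rewrite -(prime_idealDl _ pp gg') subrK.
  have g'0 : g' != 0.
    apply: contraTneq mg => g'0; move/perm_mem/(_ m): sg'.
    rewrite g'0 msupp0 in_nil mem_filter /Q mp /= => /esym; move=> ->.
    by [].
  have := mlead_supp g'0; rewrite (perm_mem sg') mem_filter => /andP[lp _].
  move: g'p; rewrite fP inE => /allP/(_ (mlead f + mlead g')%MM).
  rewrite -mleadM // mlead_supp ?mulf_neq0 // => /(_ isT).
  by rewrite mleadM // addmC (negbTE (key _ _ lp mf)).
rewrite [g]mpolyE big_seq; apply: prime_ideal_sum => // k /gC kC.
by rewrite -mul_mpolyC; apply: prime_idealMl => //; rewrite prime_mpolyX.
Qed.

(** Multiplication by ['X_[m]] translates exponents, so the colon ideal by it can be computed term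
    by term. *)
Lemma associated_prime_var_ideal J C m :
    (forall k, J (m + k)%MM = meets C k) ->
  associated_prime (mon_ideal J) (var_ideal C).
Proof.
move=> JC; split; first exact: prime_var_ideal.
exists 'X_[m] => g; rewrite mulrC !mem_mon_ideal (perm_all _ (msuppMX _ _)) [RHS]all_map.
by apply: eq_all => k /=; rewrite JC.
Qed.

(** * Heights of the primes generated by variables *)

Lemma var_ideal_msym (s : 'S_n) C f :
  (msym s f \in var_ideal C) = (f \in var_ideal (s @^-1: C)).
Proof.
have E m : meets C m = meets (s @^-1: C) [multinom m (s i) | i < n].
  apply/existsP/existsP => -[i /andP[iC mi]].
    by exists (s^-1 i)%g; rewrite inE mnmE permKV iC.
  by exists (s i); move: iC mi; rewrite inE mnmE => ->.
rewrite !inE; apply/allP/allP => fC m.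
  move=> mf; have := fC [multinom m (s^-1 i)%g | i < n].
  rewrite E mcoeff_msupp mcoeff_sym.
  have -> : [multinom [multinom m ((s^-1)%g i0) | i0 < n] (s i) | i < n] = m.
    by apply/mnmP => i; rewrite !mnmE permK.
  by rewrite -mcoeff_msupp; apply.
by rewrite mcoeff_msupp mcoeff_sym -mcoeff_msupp E; exact: fC.
Qed.

(** Each set is listed first, followed by its complement; the permutation matches equal positions of
    the two lists. *)
Lemma exists_perm_preim (C C' : {set 'I_n}) : #|C| = #|C'| ->
  exists s : 'S_n, s @^-1: C = C'.
Proof.
move=> CC'; pose l (A : {set 'I_n}) := enum A ++ enum (~: A).
have ul A : uniq (l A).
  rewrite cat_uniq !enum_uniq /= andbT; apply/hasPn => i.
  by rewrite !mem_enum inE.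
have sl A : size (l A) = n by rewrite size_cat -!cardE cardsC card_ord.
have il A i : i \in l A by rewrite mem_cat !mem_enum inE orbN.
have xl A i : (index i (l A) < n)%N by rewrite -[X in (_ < X)%N](sl A) index_mem.
have inj : injective (fun i => nth i (l C) (index i (l C'))).
  move=> i j; rewrite (set_nth_default j) ?sl // => /eqP.
  by rewrite nth_uniq ?sl // => /eqP; move/(congr1 (nth i (l C'))); rewrite !nth_index.
exists (perm inj); apply/setP => i; rewrite inE permE.
have key A j (z : 'I_n) : (j < n)%N -> (nth z (l A) j \in A) = (j < #|A|)%N.
  move=> jn; rewrite nth_cat -cardE; case: ltnP => jA.
    by rewrite -mem_enum mem_nth // -cardE.
  apply/negbTE; rewrite -in_setC -mem_enum mem_nth // -cardE.
  by rewrite -(ltn_add2l #|A|) subnKC // cardsC card_ord.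
by rewrite key // CC' -(key C' _ i) // nth_index.
Qed.

Lemma prime_chain_card C C' h : #|C| = #|C'| ->
  prime_chain (var_ideal C) h -> prime_chain (var_ideal C') h.
Proof.
move=> /exists_perm_preim[s <-] ch.
apply: (@eq_prime_chain _ [pred f | msym s f \in var_ideal C]).
  by move=> f; rewrite -var_ideal_msym inE.
apply: prime_chain_preim ch => g; exists (msym s^-1%g g).
by rewrite /= -msymMm mulVg msym1m.
Qed.

Lemma has_height_eq p q h : p =i q -> has_height p h -> has_height q h.
Proof.
move=> pq [ch mx]; split; first exact: eq_prime_chain ch.
by move=> h' ch'; apply: mx; apply: eq_prime_chain ch' => x; rewrite pq.
Qed.

Lemma has_height_card C C' h : #|C| = #|C'| ->
  has_height (var_ideal C) h -> has_height (var_ideal C') h.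
Proof.
move=> CC' [ch mx]; split; first exact: prime_chain_card ch.
by move=> h' ch'; apply: mx; apply: prime_chain_card ch'.
Qed.

Lemma var_ideal_sub C C' : C \subset C' -> {subset var_ideal C <= var_ideal C'}.
Proof.
move=> CC' f; rewrite !inE => /allP fC; apply/allP => m /fC /existsP[i /andP[iC mi]].
by apply/existsP; exists i; rewrite mi (subsetP CC').
Qed.

(** If [C'] were larger, a longest chain for [C] could be moved to a subset [A] of [C'] with [#|C|]
    elements and extended by one step. A longest chain exists by [prime_chain_le]. *)
Lemma same_height_card_le C C' :
    (forall h, has_height (var_ideal C) h <-> has_height (var_ideal C') h) ->
  (#|C'| <= #|C|)%N.
Proof.
move=> hC; rewrite leqNgt; apply/negP => CC'.
have [h hh] := prime_chain_bounded_height (prime_var_ideal C)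
  (fun h => @prime_chain_le K n _ h).
have [_ mx] := (hC h).1 hh.
have [A [AC' cA]] : exists A : {set 'I_n}, A \subset C' /\ #|A| = #|C|.
  exists [set i in take #|C| (enum C')]; split.
    by apply/subsetP => i; rewrite inE => /mem_take; rewrite mem_enum.
  by rewrite cardsE (card_uniqP _) ?take_uniq ?enum_uniq // size_take -cardE CC'.
have /mx : prime_chain (var_ideal C') h.+1.
  apply: (@prime_chainS _ (var_ideal A)); first exact: prime_var_ideal.
  - exact: var_ideal_sub.
  - move=> sub; have /subsetPn[i iC' iA] : ~~ (C' \subset A).
      by apply/negP => /subset_leq_card; rewrite cA leqNgt CC'.
    have := sub 'X_i; rewrite !var_idealX !meetsU iC' => /(_ isT).
    by rewrite (negbTE iA).
  - by apply: prime_chain_card hh.1; rewrite cA.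
by rewrite ltnn.
Qed.

Lemma unmixed_mon_ideal J : (forall k m, J m -> J (k + m)%MM) ->
  unmixed (mon_ideal J) <->
  forall C C' m m', (forall k, J (m + k)%MM = meets C k) ->
    (forall k, J (m' + k)%MM = meets C' k) -> #|C| = #|C'|.
Proof.
move=> J_up; split=> [um C C' m m' mC mC'|H p q].
  have aC := associated_prime_var_ideal mC; have aC' := associated_prime_var_ideal mC'.
  by apply/eqP; rewrite eqn_leq !same_height_card_le //; exact: um.
move=> /associated_prime_mon_ideal -/(_ J_up) [C [m [pC mC]]].
move=> /associated_prime_mon_ideal -/(_ J_up) [C' [m' [qC' mC']]] h.
have CC' := H _ _ _ _ mC mC'.
split=> hh.
  apply: (@has_height_eq (var_ideal C')) => [x|]; first by rewrite qC'.
  by apply: has_height_card CC' _; exact: has_height_eq hh.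
apply: (@has_height_eq (var_ideal C)) => [x|]; first by rewrite pC.
by apply: has_height_card (esym CC') _; exact: has_height_eq hh.
Qed.

End MonomialIdeals.

(** * Matchings and independent sets *)

Section Graphs.

Variables (T : finType) (e : rel T).
Hypotheses (e_sym : ssrbool.symmetric e) (e_irr : irreflexive e).
Implicit Types (S C Q : {set T}) (M : {set {set T}}) (x y : T).

Definition independent S := [forall x in S, forall y in S, ~~ e x y].

Lemma independentP S :
  reflect {in S &, forall x y, ~~ e x y} (independent S).
Proof.
apply: (iffP forall_inP) => [H x y xS yS|H x xS].
  by move/forall_inP: (H x xS); apply.
by apply/forall_inP => y yS; exact: H.
Qed.

Lemma mem_edges x y : ([set x; y] \in edges e) = e x y.
Proof.
apply/imset2P/idP => [[u v _ uv E]|xy]; last by exists x y.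
have uv' : e u v by [].
have v_ne_u : v <> u by move=> vu; rewrite vu e_irr in uv'.
have /set2P[xu|xv] : x \in [set u; v] by rewrite -E set21.
  have /set2P[yu|->] : y \in [set u; v] by rewrite -E set22.
    have : v \in [set x; y] by rewrite E set22.
    by rewrite xu yu => /set2P[].
  by rewrite xu.
have /set2P[->|yv] : y \in [set u; v] by rewrite -E set22.
  by rewrite xv e_sym.
have : u \in [set x; y] by rewrite E set21.
by rewrite xv yv => /set2P[/esym|/esym].
Qed.

Lemma edgesP A : A \in edges e -> exists x y, e x y /\ A = [set x; y].
Proof. by case/imset2P => x y _ xy ->; exists x, y. Qed.

Lemma vertex_coverC S : vertex_cover e (~: S) = independent S.
Proof.
apply/forall_inP/independentP => [H x y xS yS|H A].
  apply/negP => xy; have := H [set x; y]; rewrite mem_edges => /(_ xy) /set0Pn[z].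
  by rewrite !inE => /andP[zS /orP[]/eqP zE]; move: zS; rewrite zE ?xS ?yS.
case/edgesP => x [y [xy ->]]; apply/set0Pn.
case: (boolP (x \in S)) => xS; last by exists x; rewrite !inE eqxx xS.
exists y; rewrite !inE eqxx orbT andbT; apply/negP => yS.
by move: (H x y xS yS); rewrite xy.
Qed.

(** A vertex of [Q] without neighbors in a maximal [S] could be added to it. Restricting to [Q]
    allows [S] to avoid prescribed vertices. *)
Lemma maximal_independent S0 Q : independent S0 -> S0 \subset Q ->
  exists S, [/\ independent S, S0 \subset S, S \subset Q &
    forall x, x \in Q -> x \notin S -> exists2 y, y \in S & e x y].
Proof.
move=> S0i S0Q; pose P S := independent S && (S \subset Q).
have PS0 : P S0 by rewrite /P S0i.
have [S /maxsetP[/andP[Si SQ] Smax] S0S] := maxset_exists PS0.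
exists S; split=> // x xQ xS; apply: contrapT => H.
suff : x |: S = S by move/setP/(_ x); rewrite setU11 (negbTE xS).
apply: Smax; last exact: subsetUr.
apply/andP; split; last by rewrite subUset sub1set xQ.
have xn y : y \in S -> ~~ e x y by move=> yS; apply/negP => xy; apply: H; exists y.
apply/independentP => u v /setU1P[->|uS] /setU1P[->|vS].
- by rewrite e_irr.
- exact: xn.
- by rewrite e_sym xn.
- exact: (independentP _ Si).
Qed.

Lemma sum_card_setI M C : trivIset M ->
  (\sum_(A in M) #|C :&: A| = #|C :&: cover M|)%N.
Proof.
move=> tM; rewrite -sum1_card (eq_bigl (fun x => (x \in cover M) && (x \in C))).
  rewrite big_trivIset_cond //; apply: eq_bigr => A _.
  by rewrite -sum1_card; apply: eq_bigl => x; rewrite inE andbC.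
by move=> x; rewrite inE andbC.
Qed.

Lemma matching_le_vertex_cover M C : matching e M -> vertex_cover e C ->
  (#|M| <= #|C|)%N.
Proof.
move=> /andP[/subsetP Me tM] /forall_inP Cv.
apply: leq_trans (subset_leq_card (subsetIl C (cover M))).
rewrite -sum_card_setI // -sum1_card; apply: leq_sum => A /Me /Cv.
by rewrite card_gt0.
Qed.

(** The disjoint edges of [M] each contain a vertex of [C]; equal sizes leave no room for a second
    one, or for one outside [cover M]. *)
Lemma matching_eq_vertex_cover M C : matching e M -> vertex_cover e C ->
  #|C| = #|M| -> C \subset cover M /\ forall A, A \in M -> #|C :&: A| = 1%N.
Proof.
move=> /andP[/subsetP Me tM] /forall_inP Cv CM.
have := @leqif_sum _ (mem M) (fun A => 1 == #|C :&: A|)%N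
  (fun=> 1%N) (fun A => #|C :&: A|).
rewrite sum1_card sum_card_setI // -CM => -[A /Me /Cv|].
  by rewrite -card_gt0 => ?; split.
move=> le eq; have le' := subset_leq_card (subsetIl C (cover M)).
have eqC : #|C :&: cover M| = #|C| by apply/eqP; rewrite eqn_leq le le'.
split; last by move: eq; rewrite eqC eqxx => /esym/forall_inP H A /H /eqP.
by apply/setIidPl/eqP; rewrite eqEcard subsetIl eqC /=.
Qed.

Lemma KoenigP : Koenig e ->
  exists M C, [/\ matching e M, vertex_cover e C & #|C| = #|M|].
Proof.
rewrite /Koenig /vertex_cover_number /matching_number => K.
(* The empty matching ensures that the maximum is attained, and the cover by all vertices that the
   [arg min] is a cover. *)
have m0 : matching e set0.
  by rewrite /matching sub0set; apply/trivIsetP => A B; rewrite inE.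
have [|M Mm ME] := @eq_bigmax_cond _ (matching e) (fun M => #|M|).
  by apply/card_gt0P; exists set0.
have vT : vertex_cover e [set: T].
  apply/forall_inP => A /edgesP[x [y [_ ->]]]; apply/set0Pn.
  by exists x; rewrite !inE eqxx.
move: K; case: arg_minnP => // C Cv _ CE; exists M, C; split=> //.
by rewrite CE -ME; apply: eq_bigl.
Qed.

End Graphs.

(** * The edge ideal of a weighted oriented graph *)

Section StrongCovers.

Variables (n : nat) (D : wograph 'I_n).
Local Notation e := (underlying D).
Implicit Types (C S : {set 'I_n}) (m k : 'X_{1..n}) (x y : 'I_n).

Lemma underlying_sym : ssrbool.symmetric e.
Proof. by move=> x y; rewrite /underlying orbC. Qed.

Lemma arc_irr x : arc D x x = false.
Proof. by apply/negP => xx; move: (arc_asym xx); rewrite xx. Qed.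

Lemma underlying_irr : irreflexive e.
Proof. by move=> x; rewrite /underlying arc_irr. Qed.

Lemma mem_nbhd x y : (y \in nbhd D x) = e x y.
Proof. by rewrite !inE. Qed.

(** The exponents of the monomials in the edge ideal: the ends of an arc are distinct, so
    divisibility by its generator is tested on each exponent separately. *)
Definition in_edge_ideal m :=
  [exists x, exists y, [&& arc D x y, (0 < m x)%N & (weight D y <= m y)%N]].

Lemma in_edge_idealP m :
  reflect (exists x y, [/\ arc D x y, (0 < m x)%N & (weight D y <= m y)%N])
          (in_edge_ideal m).
Proof.
apply: (iffP existsP) => [[x /existsP[y /and3P[? ? ?]]]|[x [y [? ? ?]]]].
  by exists x, y.
by exists x; apply/existsP; exists y; apply/and3P.
Qed.

Lemma in_edge_ideal_up k m : in_edge_ideal m -> in_edge_ideal (k + m)%MM.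
Proof.
case/in_edge_idealP => x [y [xy mx my]]; apply/in_edge_idealP; exists x, y.
by rewrite !mnmDE addn_gt0 mx orbT (leq_trans my) // leq_addl.
Qed.

(* [m] is a monomial with [(I(D) : m)] generated by the variables in [C]. *)
Definition strong_cover C m := forall k, in_edge_ideal (m + k)%MM = meets C k.

(** This monomial supplies every factor of a generator outside [C]. Its product with [m] still lies
    outside the ideal, which shows what [m] lacks on [C]. *)
Definition off_cover C : 'X_{1..n} :=
  [multinom if i \in C then 0 else weight D i | i < n].

Lemma meets_off_cover C : meets C (off_cover C) = false.
Proof. by apply/existsP => -[x /andP[xC]]; rewrite mnmE xC. Qed.

Lemma strong_cover_arc C m x y : strong_cover C m -> arc D x y ->
  (x \in C /\ m x = 0%N) \/ (y \in C /\ (m y < weight D y)%N).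
Proof.
move=> Cm xy; apply: contrapT => H.
suff : in_edge_ideal (m + off_cover C)%MM by rewrite Cm meets_off_cover.
apply/in_edge_idealP; exists x, y; rewrite !mnmDE !mnmE; split=> //.
  case: ifP => xC; last by rewrite addn_gt0 weight_gt0 orbT.
  by rewrite addn0 lt0n; apply/eqP => mx; apply: H; left.
case: ifP => yC; last by rewrite leq_addl.
by rewrite addn0 leqNgt; apply/negP => my; apply: H; right.
Qed.

(** One more factor [x] brings the product of [m] and [off_cover C] into the ideal, so the generator
    dividing it has [x] as tail or head of its arc. *)
Lemma strong_cover_witness C m x : strong_cover C m -> x \in C ->
  (exists y, arc D x y /\ (y \in C -> weight D y <= m y)%N) \/
  (exists y, [/\ arc D y x, (weight D x <= (m x).+1)%N & (y \in C -> 0 < m y)%N]).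
Proof.
move=> Cm xC.
have : in_edge_ideal (m + (off_cover C + U_(x)))%MM by rewrite Cm meetsD meetsU xC orbT.
case/in_edge_idealP => u [v [uv]]; rewrite !mnmDE !mnmE.
have [xu|xu] := eqVneq x u.
  subst u; rewrite xC => _.
  have -> : x == v = false by apply: contraTF uv => /eqP <-; rewrite arc_irr.
  by rewrite addn0 => vw; left; exists v; split=> // vC; move: vw; rewrite vC addn0.
have [xv|xv] := eqVneq x v.
  subst v; rewrite xC addn0 add0n addn1 => mu wx; right; exists u; split=> // uC.
  by move: mu; rewrite uC addn0.
rewrite !addn0 => mu mv.
suff : in_edge_ideal (m + off_cover C)%MM by rewrite Cm meets_off_cover.
by apply/in_edge_idealP; exists u, v; rewrite !mnmDE !mnmE.
Qed.

Lemma strong_cover_is_cover C m : strong_cover C m -> vertex_cover e C.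
Proof.
move=> Cm; rewrite -[C]setCK (vertex_coverC underlying_sym underlying_irr).
apply/independentP => x y; rewrite !inE => xC yC.
apply/negP => /orP[] /(strong_cover_arc Cm) [] [].
all: by rewrite ?(negbTE xC) ?(negbTE yC).
Qed.

(* With exponent 0, one more factor [x] completes an arc from [x] into [S]; with
   exponent [weight D x - 1], it completes an arc into [x]. *)
Lemma strong_cover_setC S : independent e S ->
    (forall x, x \notin S -> (exists2 y, y \in S & e x y) \/
      exists a, [/\ arc D a x, (1 < weight D a)%N, a \notin S &
                    forall y, y \in S -> ~~ arc D a y]) ->
  exists m, strong_cover (~: S) m.
Proof.
move=> /independentP Si Smax.
pose out x := [exists y in S, arc D x y].
pose m := [multinom if x \in S then weight D x else
                      if out x then 0%N else (weight D x).-1 | x < n].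
have mS x : x \in S -> m x = weight D x by move=> xS; rewrite mnmE xS.
have mC x : x \notin S -> m x = if out x then 0%N else (weight D x).-1.
  by move=> xS; rewrite mnmE (negbTE xS).
have mlt x : x \notin S -> (m x < weight D x)%N.
  move=> xS; rewrite mC //; case: ifP; rewrite ?weight_gt0 // prednK ?weight_gt0 //.
exists m => k; apply/in_edge_idealP/existsP => [[x [y [xy]]]|[x /andP[]]].
  rewrite !mnmDE => mx my; apply: contrapT => kC.
  have k0 z : z \notin S -> k z = 0%N.
    move=> zS; apply/eqP; rewrite -leqn0 leqNgt; apply/negP => kz.
    by apply: kC; exists z; rewrite inE zS.
  (* The head must lie in [S], as [m] stays below the weight elsewhere; the tail is then outside [S]
     with exponent 0. *)
  have [yS|yS] := boolP (y \in S); last first.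
    by move: my; rewrite (k0 y) // addn0 leqNgt mlt.
  have [xS|xS] := boolP (x \in S).
    by move: (Si x y xS yS); rewrite /underlying xy.
  move: mx; rewrite k0 // addn0 mC //.
  by have -> : out x by apply/exists_inP; exists y.
rewrite inE => xS kx.
have fromS y : arc D y x -> ~~ out x -> (0 < m y)%N ->
    exists x0 y0, [/\ arc D x0 y0, (0 < (m + k)%MM x0)%N
                    & (weight D y0 <= (m + k)%MM y0)%N].
  move=> yx xo my; exists y, x; rewrite !mnmDE addn_gt0 my; split=> //.
  rewrite mC // (negbTE xo); apply: leq_trans (leqSpred _) _.
  by rewrite -addn1 leq_add2l.
have [/exists_inP[y yS xy]|xo] := boolP (out x).
  exists x, y; rewrite !mnmDE addn_gt0 kx orbT; split=> //.
  by rewrite mS // leq_addr.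
case: (Smax x xS) => [[y yS /orP[xy|yx]]|[a [ax wa aS aout]]].
- by case/exists_inP: xo; exists y.
- by apply: (fromS y) => //; rewrite mS // weight_gt0.
(* No arc leads from [a] into [S], so [m a] is [weight D a - 1], which is positive. *)
- apply: (fromS a) => //; rewrite mC //.
  have -> : out a = false.
    by apply/exists_inP => -[y yS]; rewrite (negbTE (aout y yS)).
  by rewrite -subn1 subn_gt0.
Qed.

(** The edges of [P] partition the vertices, so it suffices that [C] contains exactly one end of
    each. *)
Lemma strong_cover_card P C m :
    perfect_matching e P -> property_P e P -> weight_condition D P ->
  strong_cover C m -> #|C| = #|P|.
Proof.
move=> /andP[/andP[/subsetP Pe tP] /eqP cP] pP wP Cm.
have Cv := strong_cover_is_cover Cm.
suff C1 A : A \in P -> #|C :&: A| = 1%N.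
  by rewrite -[C in LHS]setIT -cP -sum_card_setI // (eq_bigr _ C1) sum1_card.
move=> AP; have /edgesP[b [b' [bb' AE]]] := Pe A AP.
(* At most one endpoint of [b b'] lies in [C]: witnesses for both endpoints
   would be adjacent, and their arc contradicts [strong_cover_arc]. *)
have nbr x : x \in C -> exists a, e a x /\ forall c,
    (arc D a c -> ~ (a \in C /\ m a = 0%N)) /\
    (arc D c a -> ~ (a \in C /\ (m a < weight D a)%N) \/
                  (arc D a x /\ (1 < weight D a)%N)).
  move=> xC; have [[y [xy wy]]|[y [yx wx my]]] := strong_cover_witness Cm xC.
    exists y; split; first by rewrite /underlying xy orbT.
    move=> c; split=> [_ [yC my]|_].
      by have := wy yC; rewrite my leqNgt weight_gt0.
    by left => -[/wy]; rewrite leqNgt => /negP.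
  exists y; split; first by rewrite /underlying yx.
  move=> c; split=> [_ [yC my0]|_]; first by have := my yC; rewrite my0.
  (* If [y] has weight 1, a positive exponent already reaches the weight; a larger weight is the
     exceptional case. *)
  have [w1|w1] := ltnP 1 (weight D y); [by right | left].
  by case=> /my y0; rewrite ltnNge (leq_trans w1 y0).
have excl x x' : [set x; x'] \in P -> x \in C -> x' \in C -> False.
  move=> xxP /nbr[a [ax aH]] /nbr[a' [ax' aH']].
  (* Both alternatives of [strong_cover_arc] fail on the arc from [a1] to [a2], unless [a2] has
     weight above 1 and an arc to [x2]; then the weight condition yields the reverse arc. *)
  have no a1 x1 a2 x2 : [set x1; x2] \in P -> e a1 x1 ->
      (forall c, arc D a1 c -> ~ (a1 \in C /\ m a1 = 0%N)) ->
      (forall c, arc D c a2 -> ~ (a2 \in C /\ (m a2 < weight D a2)%N) \/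
                   (arc D a2 x2 /\ (1 < weight D a2)%N)) -> arc D a1 a2 -> False.
    move=> P12 e1 H1 H2 a12.
    have [|C2] := strong_cover_arc Cm a12; first exact: H1 a12.
    have [/(_ C2)//|[a2x2 w2]] := H2 _ a12.
    have /subsetP/(_ a1) : nbhd D x1 \subset out_nbhd D a2.
      by apply: (wP a2 x1 x2); rewrite // inE.
    rewrite mem_nbhd underlying_sym inE => /(_ e1) a21.
    by move: (arc_asym a12); rewrite a21.
  have : e a a' by apply: (pP a x a' x').
  case/orP => [aa'|a'a].
    by apply: (no a x a' x') aa' => // c; [case: (aH c) | case: (aH' c)].
  apply: (no a' x' a x) a'a => //; first by rewrite setUC.
    by move=> c; case: (aH' c).
  by move=> c; case: (aH c).
apply/eqP; rewrite eqn_leq card_gt0 (forall_inP Cv) ?Pe // andbT leqNgt.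
apply/negP => /card_gt1P[x [y []]].
rewrite AE !inE => /andP[xC xbb] /andP[yC ybb] xy; rewrite AE in AP.
case/orP: xbb ybb xC yC xy => /eqP -> /orP[]/eqP -> xC yC; rewrite ?eqxx // => _.
  exact: excl AP xC yC.
exact: excl AP yC xC.
Qed.

Lemma strong_cover_perfect_matching :
    (forall x, ~~ isolated D x) -> Koenig e ->
    (forall C C' m m', strong_cover C m -> strong_cover C' m' -> #|C| = #|C'|) ->
  exists P, [/\ perfect_matching e P, property_P e P & weight_condition D P].
Proof.
move=> niso /KoenigP [M [C0 [Mm C0v C0M]]] uni.
have es := underlying_sym; have ei := underlying_irr.
have nbr x : exists y, e x y.
  by have /set0Pn[y] := niso x; rewrite mem_nbhd; exists y.
have ext S0 : independent e S0 -> exists S,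
    [/\ S0 \subset S, independent e S & exists m, strong_cover (~: S) m].
  move=> S0i; have [S [Si S0S _ Smax]] := maximal_independent es ei S0i (subsetT _).
  by exists S; split=> //; apply: strong_cover_setC => // x xS; left; exact: Smax.
(* Extending the complement of [C0] to a maximal independent set gives a strong cover inside [C0],
   of size [#|M|]; all others have the same size. *)
have cardM C m : strong_cover C m -> #|C| = #|M|.
  have [|S [C0S Si [mS mSc]]] := ext (~: C0); first by rewrite -vertex_coverC ?setCK.
  move/uni => /(_ _ _ mSc) ->; apply/eqP; rewrite eqn_leq -{1}C0M subset_leq_card.
    by rewrite (matching_le_vertex_cover Mm) // vertex_coverC.
  by rewrite -[C0]setCK setCS.
have one C m : strong_cover C m ->
    C \subset cover M /\ forall A, A \in M -> #|C :&: A| = 1%N.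
  move=> Cm; have Cv := strong_cover_is_cover Cm.
  exact: matching_eq_vertex_cover Mm Cv (cardM _ _ Cm).
have not2 S m b b' : strong_cover (~: S) m -> [set b; b'] \in M ->
    b \notin S -> b' \notin S -> False.
  move=> /one[_ H] bM bS b'S; have := H _ bM.
  have -> : ~: S :&: [set b; b'] = [set b; b'].
    by apply/setIidPr/subsetP => z /set2P[]->; rewrite inE.
  have bb' : e b b' by rewrite -mem_edges //; move: bM; apply/subsetP; case/andP: Mm.
  by rewrite cards2; case: eqP bb' => // ->; rewrite ei.
have pP : property_P e M.
  move=> a b a' b' ab ab' bM; apply: contraT => naa'.
  (* If [a] and [a'] were not adjacent, an independent set containing both would avoid [b] and [b'],
     so its complement would contain both ends of an edge of [M]. *)
  have [|S [/subsetP aS Si [m mSc]]] := ext [set a; a'].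
    apply/independentP => u v /set2P[]-> /set2P[]->; rewrite ?ei //.
    by rewrite es.
  have out x y : x \in S -> e x y -> y \notin S.
    move=> xS xy; apply/negP => yS.
    by move/independentP: Si => /(_ x y xS yS); rewrite xy.
  exfalso; apply: (not2 _ _ _ _ mSc bM).
    by apply: out ab; rewrite aS // set21.
  by apply: out ab'; rewrite aS // set22.
exists M; split=> //.
  apply/andP; split=> //; rewrite -subTset; apply/subsetP => v _.
  (* A strong cover that avoids the neighbor [u] contains [v], and it lies in [cover M]. *)
  have [u vu] := nbr v.
  have [|S [/subsetP uS Si [m mSc]]] := ext [set u].
    by apply/independentP => ? ? /set1P-> /set1P->; rewrite ei.
  have [/subsetP sub _] := one _ _ mSc; apply: sub; rewrite inE; apply/negP => vS.
  by move/independentP: Si => /(_ v u vS); rewrite vu uS ?set11 // => /(_ isT).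
move=> a b b' wa; rewrite inE => ab' bM; apply/subsetP => c.
rewrite mem_nbhd inE => bc.
have ca : e a c.
  by rewrite es; apply: (pP c b a b') bM; rewrite /underlying ?ab' // orbC.
case/orP: (ca) => // ca'; exfalso.
have nac : ~~ arc D a c by exact: arc_asym.
pose Q := ~: (a |: out_nbhd D a).
have [||S [Si cS /subsetP SQ Smax]] := @maximal_independent _ _ es ei [set c] Q.
- by apply/independentP => ? ? /set1P-> /set1P->; rewrite ei.
- rewrite sub1set !inE negb_or nac andbT.
  by apply: contraTneq ca => ->; rewrite ei.
rewrite sub1set in cS.
have aS : a \notin S by apply/negP => /SQ; rewrite !inE eqxx.
have outS y : y \in S -> ~~ arc D a y by move/SQ; rewrite !inE negb_or => /andP[].
have [|m mSc] := strong_cover_setC Si.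
  (* Vertices of [Q] have a neighbor in [S] by maximality, and [a] has the neighbor [c];
     out-neighbors of [a] use the second alternative, as no arc leads from [a] into [S]. *)
  move=> x xS; have [xQ|] := boolP (x \in Q); first by left; exact: Smax.
  rewrite !inE negbK => /orP[/eqP ->|ax]; first by left; exists c.
  by right; exists a.
apply: (not2 _ _ _ _ mSc bM); last by apply: contraTN ab' => /outS.
by apply/negP => bS; move/independentP: Si => /(_ b c bS cS); rewrite bc.
Qed.

(** For the harder inclusion, a generator dividing each monomial of [f] is chosen, which writes [f]
    term by term as a combination of generators. *)
Lemma edge_idealE (K : fieldType) :
  edge_ideal K D = mon_ideal in_edge_ideal.
Proof.
apply/funext => f; apply/asboolP/idP => [[s [sD ->]]|].
  have H := @mon_ideal_sum K n in_edge_ideal _ s (fun cg => cg.1 * cg.2).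
  apply: H => cg /sD [i [j [ij ->]]]; apply: mon_idealMl; first exact: in_edge_ideal_up.
  rewrite mpolyXn -mpolyXD mon_idealX; apply/in_edge_idealP; exists i, j.
  rewrite !mnmDE !mulmnE !mnm1E !eqxx.
  by split=> //; rewrite ?mul1n ?leq_addl // addn_gt0.
move=> /allP fI.
have /choice[g gP] : forall m, exists g : {mpoly K[n]} * {mpoly K[n]},
    m \in msupp f ->
    (exists i j : 'I_n, arc D i j /\ g.2 = 'X_i * 'X_j ^+ weight D j) /\
    f@_m *: 'X_[m] = g.1 * g.2.
  move=> m; case: (boolP (m \in msupp f)) => [/fI/in_edge_idealP|_]; last first.
    by exists (0, 0).
  case=> i [j [ij mi mj]].
  pose d := (U_(i) + U_(j) *+ weight D j)%MM.
  exists (f@_m *: 'X_[m - d], 'X_i * 'X_j ^+ weight D j) => _.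
  split; first by exists i, j.
  rewrite /= mpolyXn -mpolyXD -/d -scalerAl -mpolyXD submK //.
  apply/mnm_lepP => l; rewrite mnmDE mulmnE !mnm1E.
  case: eqVneq => [<-|_]; last by case: eqVneq => [<-|_]; rewrite ?mul0n ?mul1n.
  by case: eqVneq ij => [->|_ _]; rewrite ?arc_irr // mul0n.
exists [seq g m | m <- msupp f]; split.
  by move=> _ /mapP[m mf ->]; have [] := gP m mf.
rewrite big_map {1}[f]mpolyE big_seq [RHS]big_seq.
by apply: eq_bigr => m mf; have [] := gP m mf.
Qed.

End StrongCovers.

Theorem theorem3p4 (K : fieldType) (n : nat) (D : wograph 'I_n)
    (no_isolated : forall x : 'I_n, ~~ isolated D x)
    (source_weight : forall x : 'I_n, source D x -> weight D x = 1%N)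
    (sink_weight : forall x : 'I_n, sink D x -> weight D x = 1%N)
    (GKoenig : Koenig (underlying D)) :
  unmixed (edge_ideal K D) <->
  exists P : {set {set 'I_n}},
    [/\ perfect_matching (underlying D) P,
        property_P (underlying D) P
      & weight_condition D P].
Proof.
rewrite edge_idealE unmixed_mon_ideal; last exact: in_edge_ideal_up.
split=> [uni|[P [pP qP wP]] C C' m m' Cm Cm'].
  exact: strong_cover_perfect_matching.
by rewrite (strong_cover_card pP qP wP Cm) (strong_cover_card pP qP wP Cm').
Qed.
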